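(* Let $\boldsymbol{X}=(X_1,\dots,X_n)$ be a real random vector with finite second moments, let $N=\{1,\dots,n\}$, and for $J\subset N$ let $S_J=\sum_{i\in J}X_i$. Let $\nu:2^N\to\mathbb{R}$ be the variance game defined by $\nu(J)=\operatorname{Var}[S_J]$ for every $J\subset N$. Then for every $i\in N$ the Shapley value of $\nu$ satisfies \[ \phi_i(\nu)=\operatorname{Cov}[X_i,S_N]. \]
   Context: A cooperative game on the player set $N=\{1,\dots,n\}$ is a function $\nu:2^N\to\mathbb{R}$ with $\nu(\varnothing)=0$ (an empty sum of random variables is $0$). The Shapley value of a game $\nu$ is the vector $\boldsymbol{\phi}(\nu)=(\phi_1(\nu),\dots,\phi_n(\nu))\in\mathbb{R}^n$ given by \[ \phi_i(\nu)=\sum_{J\subset N\setminus\{i\}}\frac{|J|!\,(n-|J|-1)!}{n!}\bigl(\nu(J\cup\{i\})-\nu(J)\bigr)=\frac{1}{n!}\sum_{\psi\in\mathcal{P}(N)}\bigl(\nu(P^{\psi}(i)\cup\{i\})-\nu(P^{\psi}(i))\bigr), \] where the first sum is over all subsets $J$ of $N\setminus\{i\}$ (including the empty set), $\mathcal{P}(N)$ is the set of all permutations of $N$, and $P^{\psi}(i)$ is the set of players who precede $i$ in the order determined by the permutation $\psi$. The symbol $\subset$ allows equality. *)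

(* Defs.v *)
From HB Require Import structures.
From mathcomp Require Import all_boot all_order all_algebra.
From mathcomp Require Import all_classical all_reals all_analysis.

Set Implicit Arguments.
Unset Strict Implicit.
Unset Printing Implicit Defensive.

Import Order.TTheory GRing.Theory Num.Theory.
Import numFieldNormedType.Exports.

Local Open Scope ring_scope.

(* The player set N = {1, ..., n} is 'I_n; coalitions are the elements of
   {set 'I_n}. *)
Record coop_game (R : realType) (n : nat) := CoopGame {
  game_val :> {set 'I_n} -> R;
  game_val0 : game_val finset.set0 = 0 }.

Definition shapley (R : realType) (n : nat) (nu : coop_game R n) : 'rV[R]_n :=
  \row_i \sum_(J : {set 'I_n} | J \subset [set~ i])
    ((#|J|)`! * (n - #|J| - 1)`!)%:R / n`!%:R * (nu (i |: J)%SET - nu J).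

Section variance_game.
Context (d : measure_display) (T : measurableType d) (R : realType)
  (P : probability T R) (n : nat).

Definition coalition_sum (X : 'I_n -> {RV P >-> R}) (J : {set 'I_n}) : T -> R :=
  fun w => \sum_(j in J) X j w.

Lemma variance_coalition_sum0 (X : 'I_n -> {RV P >-> R}) :
  fine 'V_P[coalition_sum X finset.set0] = 0.
Proof.
have -> : coalition_sum X finset.set0 = cst 0.
  by apply/funext => w; rewrite /coalition_sum big_set0.
by rewrite variance_cst.
Qed.

(* The library's variance takes values in \bar R; [fine] loses nothing here when
   the second moments are finite, see [variance_gameE]. *)
Definition variance_game (X : 'I_n -> {RV P >-> R}) : coop_game R n :=
  CoopGame (game_val := fun J => fine 'V_P[coalition_sum X J])
    (variance_coalition_sum0 X).

Lemma second_moment_Lfun (X : {RV P >-> R}) :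
  ('E_P[fun w => (X w ^+ 2)%R] < +oo)%E -> (X : T -> R) \in Lfun P 2%:E.
Proof.
move=> X2; rewrite inE; apply/andP; split; rewrite inE//=.
rewrite /finite_norm unlock /= poweR_lty//.
move: X2; rewrite unlock; apply: le_lt_trans.
rewrite le_eqVlt; apply/orP; left; apply/eqP; apply: eq_integral => w _ /=.
by rewrite powR_mulrn// real_normK// num_real.
Qed.

Lemma variance_gameE (X : 'I_n -> {RV P >-> R}) (J : {set 'I_n}) :
  (forall i, ('E_P[fun w => (X i w ^+ 2)%R] < +oo)%E) ->
  (variance_game X J)%:E = 'V_P[coalition_sum X J]%E.
Proof.
move=> X2; rewrite /= fineK// variance_fin_num//.
have -> : coalition_sum X J = \sum_(j in J) (X j : T -> R).
  by apply/funext => w; rewrite fct_sumE.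
elim/big_ind: _ => [|f g f2 g2|j _]; first exact: Lfun_cst.
- by rewrite rpredD ?lee1n.
- exact: second_moment_Lfun.
Qed.

End variance_game.

(* Main.v *)
Require Import Defs.
From mathcomp Require Import all_boot all_order all_algebra.
From mathcomp Require Import all_classical all_reals all_analysis.
From mathcomp Require Import ring.

(** Write [M J] for the marginal contribution [nu (i |: J) - nu J] of player [i]
    to a coalition [J] that does not contain [i].  Since covariance is bilinear,
    [M J = Var X_i + 2 Cov (X_i, S_J)] for the variance game
    ([variance_game_marginal]).  The complement [J'] of [J] in the set of the
    other players has the same Shapley weight as [J], because
    [|J|! (n - |J| - 1)!] is symmetric in [|J|] and [|J'| = n - 1 - |J|]; and
    [M J + M J' = 2 Cov (X_i, X_i + S_J + S_J') = 2 Cov (X_i, S_N)] does not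
    depend on [J].  As the weights add up to 1 ([sum_fact_subsets]), averaging
    the sum defining the Shapley value with its image under [J |-> J'] leaves
    exactly [Cov (X_i, S_N)] ([shapley_of_complementary_marginals]).  Finite
    second moments make every covariance involved finite, so that bilinearity
    can be used on real values. *)

Import GRing.Theory Num.Theory.

Local Open Scope ring_scope.

(** With [#|B| = n - 1], this says that the Shapley weights of a player add up
    to 1: each of the [#|B| + 1] possible sizes contributes [#|B|!]. *)
Lemma sum_fact_subsets {T : finType} (B : {set T}) :
  (\sum_(J : {set T} | J \subset B) (#|J|)`! * (#|B| - #|J|)`! = #|B|.+1`!)%N.
Proof.
rewrite (partition_big (fun J : {set T} => inord #|J| : 'I_#|B|.+1) xpredT)//=.
(* The subsets of size [k] contribute ['C(#|B|, k) * k! * (#|B| - k)! = #|B|!]. *)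
transitivity (\sum_(k < #|B|.+1) (#|B|)`!)%N; last first.
  by rewrite sum_nat_const card_ord factS.
apply: eq_bigr => k _.
transitivity (\sum_(J in [set J : {set T} | (J \subset B) && (#|J| == k)]%SET)
    k`! * (#|B| - k)`!)%N.
  apply: eq_big => [J|J /andP[JB /eqP <-]].
    rewrite inE; case JB: (J \subset B) => //=.
    by rewrite -val_eqE /= inordK// ltnS subset_leq_card.
  by rewrite inordK// ltnS subset_leq_card.
by rewrite sum_nat_const cards_draws bin_fact// -ltnS.
Qed.

(** If the marginal contributions of [i] to a coalition and to its complement
    among the other players always average to the same [c], then the Shapley
    value of [i] is [c]: the two coalitions carry equal weights. *)
Lemma shapley_of_complementary_marginals {R : realType} {n : nat}
    (nu : coop_game R n) (i : 'I_n) (c : R) :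
  (forall J : {set 'I_n}, J \subset [set~ i]%SET ->
    (nu (i |: J)%SET - nu J)
    + (nu (i |: ([set~ i] :\: J))%SET - nu ([set~ i] :\: J)%SET) = c *+ 2) ->
  shapley nu 0 i = c.
Proof.
move=> marg; rewrite mxE.
pose B : {set 'I_n} := [set~ i]%SET.
have n_gt0 : (0 < n)%N by exact: leq_ltn_trans (ltn_ord i).
have cardB : #|B| = n.-1 by rewrite cardsC1 card_ord.
pose w (J : {set 'I_n}) : R := ((#|J|)`! * (#|B| - #|J|)`!)%:R / n`!%:R.
pose m (J : {set 'I_n}) : R := nu (i |: J)%SET - nu J.
have sum_w : \sum_(J : {set 'I_n} | J \subset B) w J = 1.
  by rewrite -mulr_suml -natr_sum sum_fact_subsets cardB prednK// divff//.
have w_compl (J : {set 'I_n}) : J \subset B -> w (B :\: J)%SET = w J.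
  move=> JB; rewrite /w cardsD (finset.setIidPr JB) subKn ?subset_leq_card//.
  by rewrite mulnC.
transitivity (\sum_(J : {set 'I_n} | J \subset B) w J * m J).
  by apply: eq_bigr => J _; rewrite /w cardB -subn1 subnAC.
have sum_compl : \sum_(J : {set 'I_n} | J \subset B) w J * m J
    = \sum_(J : {set 'I_n} | J \subset B) w J * m (B :\: J)%SET.
  rewrite (reindex_onto (fun J => B :\: J)%SET (fun J => B :\: J)%SET) /=; last first.
    by move=> J JB; rewrite finset.setDDr finset.setDv finset.set0U (finset.setIidPr JB).
  apply: eq_big => [J|J /andP[_ /eqP JB]]; last first.
    by rewrite w_compl// -JB subsetDl.
  rewrite subsetDl finset.setDDr finset.setDv finset.set0U/=.
  by apply/eqP/idP => [/finset.setIidPr|/finset.setIidPr].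
apply: (@mulIf R 2%:R); first by rewrite pnatr_eq0.
rewrite !mulr_natr [LHS]mulr2n {2}sum_compl -big_split /=.
transitivity (\sum_(J : {set 'I_n} | J \subset B) w J * (c *+ 2)).
  by apply: eq_bigr => J JB; rewrite -mulrDr marg.
by rewrite -mulr_suml sum_w mul1r.
Qed.

Lemma covariance_fin_num_Lfun2 {d} {T : measurableType d} {R : realType}
    (P : probability T R) (f g : T -> R) :
  f \in Lfun P 2%:E -> g \in Lfun P 2%:E -> covariance P f g \is a fin_num.
Proof.
move=> f2 g2.
by rewrite covariance_fin_num ?Lfun2_mul_Lfun1// Lfun_subset12 ?fin_num_measure.
Qed.

Lemma coalition_sumU {d} {T : measurableType d} {R : realType}
    {P : probability T R} {n : nat} (X : 'I_n -> {RV P >-> R})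
    (A B : {set 'I_n}) : [disjoint A & B] ->
  coalition_sum X (A :|: B)%SET = coalition_sum X A \+ coalition_sum X B.
Proof.
move=> AB; apply/funext => w.
by rewrite /coalition_sum /= -bigU//=; apply: eq_bigl => j; rewrite inE.
Qed.

Lemma coalition_sum1 {d} {T : measurableType d} {R : realType}
    {P : probability T R} {n : nat} (X : 'I_n -> {RV P >-> R}) (i : 'I_n) :
  coalition_sum X [set i]%SET = X i.
Proof. by apply/funext => w; rewrite /coalition_sum big_set1. Qed.

Section finite_second_moments.
Context {d} {T : measurableType d} {R : realType} {P : probability T R} {n : nat}.
Context (X : 'I_n -> {RV P >-> R})
  (X2 : forall i : 'I_n, ('E_P[fun w => (X i w ^+ 2)%R] < +oo)%E).

Lemma coalition_sum_Lfun2 (J : {set 'I_n}) : coalition_sum X J \in Lfun P 2%:E.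
Proof.
have -> : coalition_sum X J = \sum_(j in J) (X j : T -> R).
  by apply/funext => w; rewrite fct_sumE.
elim/big_ind: _ => [|f g f2 g2|j _]; first exact: Lfun_cst.
- by rewrite rpredD ?lee1n.
- exact: second_moment_Lfun.
Qed.

Lemma fine_covariance_coalition_sumU (i : 'I_n) (A B : {set 'I_n}) :
    [disjoint A & B] ->
  fine (covariance P (X i) (coalition_sum X (A :|: B)%SET))
  = fine (covariance P (X i) (coalition_sum X A))
    + fine (covariance P (X i) (coalition_sum X B)).
Proof.
move=> AB; have Xi2 := second_moment_Lfun (X2 i).
rewrite coalition_sumU// covarianceDr ?coalition_sum_Lfun2//.
by rewrite fineD// covariance_fin_num_Lfun2// coalition_sum_Lfun2.
Qed.

(** The variance of [S_J] cancels, leaving [Var X_i + 2 Cov (X_i, S_J)]. *)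
Lemma variance_game_marginal (i : 'I_n) (J : {set 'I_n}) : i \notin J ->
  variance_game X (i |: J)%SET - variance_game X J
  = fine (covariance P (X i) (X i))
    + fine (covariance P (X i) (coalition_sum X J)) *+ 2.
Proof.
move=> iJ; have Xi2 := second_moment_Lfun (X2 i).
have SJ2 := coalition_sum_Lfun2 J.
rewrite /= coalition_sumU ?disjoints1// coalition_sum1 varianceD//.
have fin_i : covariance P (X i) (X i) \is a fin_num.
  exact: covariance_fin_num_Lfun2.
have fin_J : ('V_P[coalition_sum X J])%E \is a fin_num.
  exact: covariance_fin_num_Lfun2.
have fin_iJ : covariance P (X i) (coalition_sum X J) \is a fin_num.
  exact: covariance_fin_num_Lfun2.
rewrite !fineD ?fin_numD ?fin_numM ?fin_i ?fin_J ?fin_iJ// fineM//=.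
by rewrite /variance; ring.
Qed.

End finite_second_moments.

Theorem theorem3p1 (d : measure_display) (T : measurableType d) (R : realType)
    (P : probability T R) (n : nat) (X : 'I_n -> {RV P >-> R})
    (X2 : forall i : 'I_n, ('E_P[fun w => (X i w ^+ 2)%R] < +oo)%E)
    (i : 'I_n) :
  (shapley (variance_game X) 0 i)%:E
  = covariance P (X i) (coalition_sum X [set: 'I_n]).
Proof.
have Xi2 := second_moment_Lfun (X2 i).
rewrite -[RHS]fineK ?covariance_fin_num_Lfun2 ?coalition_sum_Lfun2//.
congr EFin; apply: shapley_of_complementary_marginals => J JB.
have iJ : i \notin J by apply/negP => /(fintype.subsetP JB); rewrite !inE eqxx.
rewrite !variance_game_marginal//; last by rewrite !inE eqxx andbF.
have -> : [set: 'I_n] = ([set i] :|: (J :|: ([set~ i] :\: J)))%SET.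
  by apply/setP => j; rewrite !inE; case: (j == i); case: (j \in J).
(* The sum over all players splits into [X_i], [S_J] and the complementary sum. *)
rewrite !fine_covariance_coalition_sumU//.
- by rewrite coalition_sum1; ring.
- by rewrite -setI_eq0; apply/eqP/setP => j; rewrite !inE; case: (j \in J).
- by rewrite disjoints1 !inE eqxx andbF orbF.
Qed.
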